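(* Suppose the concept space contains only one target concept, $\mathcal{T}=\{\tau\}$, and the uniform assumption holds: the underlying label sequence $Y$ has $p(Y)=1/|\mathcal{S}(\tau)|$ for every $Y\in\mathcal{S}(\tau)$, where $\mathcal{S}(\tau)=\{Y\in\mathcal{Y}^m \mid B\cup Y\models\tau\}$. Let $$a=\max_{i\in\mathcal{Y}}\left\{\frac{1}{|\mathcal{S}(\tau)|}\sum_{Y\in\mathcal{S}(\tau)}\sum_{k=0}^{m-1}\mathbf{1}(y_k=i)\right\}.$$ For any classifier $h:\mathcal{X}\to\mathbb{R}^c$ and any knowledge base $B$, if the abduced labels $\bar Y$ are randomly selected from $\mathcal{S}(\tau)$ and $\ell$ is the cross-entropy loss, then $$\mathcal{R}_{\mathrm{L}}(h)\le \mathcal{R}_{\mathrm{NeSy}}(h)+C,$$ where $C=\log a\le\log m$ is a constant.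
   Context: Notation: $[n]=\{0,1,\dots,n-1\}$ and $\mathbf{1}(\cdot)$ is the indicator function. $\mathcal{X}\subseteq\mathbb{R}^d$ is the input space, $\mathcal{Y}=[c]$ the label space with $c$ classes, $m\ge 1$ the sequence length, and $\mathcal{T}$ a finite set of target concepts. $B$ is a knowledge base (a set of first-order logic rules) and $\models$ is logical entailment. For the purpose of this statement, $B$ matters only through the (nonempty) candidate set $\mathcal{S}(\tau)=\{Y=[y_0,\dots,y_{m-1}]\in\mathcal{Y}^m \mid B\cup Y\models\tau\}$, which may be any nonempty subset of $\mathcal{Y}^m$. Data: $p(X,\tau)$ is a distribution over input sequences $X=[x_0,\dots,x_{m-1}]\in\mathcal{X}^m$ and target concepts. The ground-truth label sequences $Y$ are unobserved. Classifier and softmax: a classifier is a (measurable) map $h:\mathcal{X}\to\mathbb{R}^c$. Put $g_j(x)=\hat p(j|x)=\exp(h_j(x))/\sum_{i=0}^{c-1}\exp(h_i(x))$ for $j\in[c]$. Cross-entropy loss: applied to $h$, $\ell(h(x),y)=-\log g_y(x)$. Applied to a vector $q(x)$ that is already interpreted as probabilities, $\ell(q(x),\iota)=-\log q_\iota(x)$. Inconsistency objective: $\mathcal{R}_{\mathrm{NeSy}}(h)=\mathbb{E}\left[\frac1m\sum_{k=0}^{m-1}\ell(h(x_k),\bar y_k)\right]$, where the expectation is over $(X,\tau)\sim p(X,\tau)$ and over the random abduced labels $\bar Y=[\bar y_0,\dots,\bar y_{m-1}]$, selected uniformly at random from $\mathcal{S}(\tau)$, independently of $X$. Location-based risk (L-Risk):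 each sequence $X$ yields the $m$ instance-location pairs $\langle x_\iota,\iota\rangle$, $\iota\in[m]$. Let $p(x,\iota)$ be the induced distribution: draw $X$, draw $\iota$ uniformly on $[m]$, and set $x=x_\iota$. Let $Q\in\mathbb{R}^{c\times m}$ be the matrix $Q_{jk}=p(\iota=k\mid y=j)$, the probability of class $j$ occurring at position $k$. Under the uniform assumption it is $$Q_{jk}=\frac{\sum_{Y\in\mathcal{S}(\tau)}\mathbf{1}(y_k=j)}{\sum_{Y\in\mathcal{S}(\tau)}\sum_{k'=0}^{m-1}\mathbf{1}(y_{k'}=j)}.$$ If a class $j$ never occurs in $\mathcal{S}(\tau)$, the row $Q_{j\cdot}$ is an arbitrary fixed probability vector. Set $q(x)=Q^\top g(x)$, i.e. $q_k(x)=\sum_j Q_{jk}g_j(x)$, and $$\mathcal{R}_{\mathrm{L}}(h)=\mathbb{E}_{p(x,\iota)}\,\ell(q(x),\iota).$$ Expectations take values in $[0,+\infty]$. *)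

(* Defs.v *)
From HB Require Import structures.
From mathcomp Require Import all_boot all_order all_algebra.
From mathcomp Require Import all_classical all_reals all_analysis.

Set Implicit Arguments.
Unset Strict Implicit.
Unset Printing Implicit Defensive.

Import Order.TTheory GRing.Theory Num.Theory.

Local Open Scope classical_set_scope.
Local Open Scope ring_scope.
Local Open Scope ereal_scope.

Record signature := Signature {
  fsym : Type;
  farity : fsym -> nat;
  psym : Type;
  parity : psym -> nat }.

Section FirstOrderLogic.
Variable L : signature.

Inductive term : Type :=
| Var of nat
| App (f : fsym L) (args : 'I_(farity f) -> term).

Inductive formula : Type :=
| Falsum
| Atom (P : psym L) (args : 'I_(parity P) -> term)
| Equal of term & term
| Imply of formula & formula
| Forall of nat & formula.

(* [dom_point] expresses that domains of interpretation are nonempty. *)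
Record interpretation := Interpretation {
  dom : Type;
  dom_point : dom;
  finterp : forall f : fsym L, ('I_(farity f) -> dom) -> dom;
  pinterp : forall P : psym L, ('I_(parity P) -> dom) -> Prop }.

Fixpoint eval (M : interpretation) (v : nat -> dom M) (t : term) : dom M :=
  match t with
  | Var n => v n
  | App f args => finterp (fun i => eval v (args i))
  end.

Definition update (D : Type) (v : nat -> D) (n : nat) (x : D) : nat -> D :=
  fun k => if k == n then x else v k.

Fixpoint sat (M : interpretation) (v : nat -> dom M) (phi : formula) : Prop :=
  match phi with
  | Falsum => False
  | Atom P args => pinterp (fun i => eval v (args i))
  | Equal s t => eval v s = eval v t
  | Imply phi1 phi2 => sat v phi1 -> sat v phi2
  | Forall n phi1 => forall x : dom M, sat (update v n x) phi1
  end.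

Definition entails (Gamma : set formula) (phi : formula) : Prop :=
  forall (M : interpretation) (v : nat -> dom M),
    (forall psi, Gamma psi -> sat v psi) -> sat v phi.

HB.instance Definition _ := gen_eqMixin formula.
HB.instance Definition _ := gen_choiceMixin formula.
HB.instance Definition _ := isPointed.Build formula Falsum.

(* Formulas carry the discrete sigma-algebra: target concepts range over a
   finite set of formulas. *)
HB.instance Definition _ := @isMeasurable.Build default_measure_display
  formula discrete_measurable discrete_measurable0
  discrete_measurableC discrete_measurableU.

End FirstOrderLogic.

Section Candidates.
Variables (L : signature) (c m : nat).

(* [fact k j] is the formula stating that the k-th input has label j. *)
Variable fact : 'I_m -> 'I_c -> formula L.

Definition label_facts (Y : m.-tuple 'I_c) : set (formula L) :=
  [set fact k (tnth Y k) | k in [set: 'I_m]].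

Definition candidates (B : set (formula L)) (tau : formula L) :
    {set m.-tuple 'I_c} :=
  finset (fun Y => `[< entails (B `|` label_facts Y) tau >]).

End Candidates.

Section InputSpace.
Variables (R : realType) (d : nat) (X : set (d.-tuple R)).

(* Measurable types are inhabited, hence the nonemptiness proof [X0]. *)
Definition points (X0 : X !=set0) : Type := X.

Variable X0 : X !=set0.

HB.instance Definition _ := Choice.on (points X0).
HB.instance Definition _ := isPointed.Build (points X0)
  (exist _ (sval (cid X0)) (mem_set (svalP (cid X0)))).

(* X with the trace of the Borel sigma-algebra of R^d. *)
Definition inputs : Type :=
  g_sigma_algebra_preimageType (fun x : points X0 => sval x : d.-tuple R).

HB.instance Definition _ := Measurable.on inputs.

End InputSpace.

Section Positions.
Variables (m : nat) (m_gt0 : (0 < m)%N).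

Definition positions of (0 < m)%N : Type := 'I_m.

HB.instance Definition _ := Choice.on (positions m_gt0).
HB.instance Definition _ := isPointed.Build (positions m_gt0)
  (Ordinal m_gt0).
HB.instance Definition _ := @isMeasurable.Build default_measure_display
  (positions m_gt0) discrete_measurable discrete_measurable0
  discrete_measurableC discrete_measurableU.

End Positions.

Section Losses.
Variable R : realType.

Definition softmax c (z : c.-tuple R) : 'cV[R]_c :=
  (\col_j (expR (tnth z j) / \sum_(i < c) expR (tnth z i)))%R.

(* Extended-real valued, with -log 0 = +oo. *)
Definition cross_entropy n (q : 'cV[R]_n) (y : 'I_n) : \bar R :=
  - lne (q y ord0)%:E.

Definition uniform_mean (I : finType) (S : {set I}) (f : I -> \bar R) :
    \bar R :=
  (#|S|%:R^-1)%:E * \sum_(i in S) f i.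

Definition probability_vector (I : finType) (p : I -> R) : Prop :=
  (forall i, 0 <= p i)%R /\ (\sum_i p i = 1)%R.

End Losses.

Section NeSyRisk.
Variables (R : realType) (dX dT : measure_display).
Variables (X : measurableType dX) (T : measurableType dT) (c m : nat).

(* The inner mean is over the abduced labels: given the target concept w.2 they
   are independent of the inputs w.1. *)
Definition nesy_risk (p : set (m.-tuple X * T) -> \bar R)
    (S : T -> {set m.-tuple 'I_c}) (h : X -> c.-tuple R) : \bar R :=
  \int[p]_w uniform_mean (S w.2) (fun Y =>
    (m%:R^-1)%:E *
    \sum_(k < m) cross_entropy (softmax (h (tnth w.1 k))) (tnth Y k)).

End NeSyRisk.

Section LocationMatrix.
Variables (R : realType) (c m : nat).

(* Law of the pair (y, iota) = (Y_iota, iota), for Y drawn from pY and iota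
   drawn independently and uniformly from the m positions. *)
Definition label_position_law (pY : m.-tuple 'I_c -> R) (j : 'I_c)
    (k : 'I_m) : R :=
  (\sum_(Y : m.-tuple 'I_c | tnth Y k == j) pY Y * m%:R^-1)%R.

Definition label_law (pY : m.-tuple 'I_c -> R) (j : 'I_c) : R :=
  (\sum_(k < m) label_position_law pY j k)%R.

(* Q j k = p(iota = k | y = j); the row of a class of probability zero is an
   arbitrary probability vector. *)
Definition location_matrix (pY : m.-tuple 'I_c -> R) (Q : 'M[R]_(c, m)) :
    Prop :=
  forall j, if label_law pY j == 0%R then probability_vector (Q j)
            else forall k, Q j k = (label_position_law pY j k / label_law pY j)%R.

End LocationMatrix.

Section LocationRisk.
Variables (R : realType) (dX dT : measure_display).
Variables (X : measurableType dX) (T : measurableType dT) (c m : nat).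
Variable m_gt0 : (0 < m)%N.

(* Law of (x_iota, iota), for (x_0, ..., x_(m-1)) drawn from p and iota drawn
   independently and uniformly from the m positions. *)
Definition instance_location_law (p : set (m.-tuple X * T) -> \bar R) :
    set (X * positions m_gt0) -> \bar R :=
  fun A => \sum_(k < m) (m%:R^-1)%:E *
    pushforward p (fun w => (tnth w.1 k, k) : X * positions m_gt0) A.

Let pair_location (k : 'I_m) : m.-tuple X * T -> X * positions m_gt0 :=
  fun w => (tnth w.1 k, k).

Let measurable_pair_location k :
  measurable_fun [set: m.-tuple X * T] (pair_location k).
Proof.
apply: measurable_fun_pair; last exact: measurable_cst.
exact: (measurableT_comp (measurable_tnth k) measurable_fst).
Qed.

Section Probability.
Variable p : probability (m.-tuple X * T)%type R.

Let law0 : instance_location_law p set0 = 0.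
Proof.
by apply: big1 => k _; rewrite /pushforward preimage_set0 measure0 mule0.
Qed.

Let law_ge0 A : 0 <= instance_location_law p A.
Proof.
by apply: sume_ge0 => k _; apply: mule_ge0; [rewrite lee_fin invr_ge0 ler0n|rewrite /pushforward measure_ge0].
Qed.

Let law_sigma_additive : semi_sigma_additive (instance_location_law p).
Proof.
have r0 : (0 <= m%:R^-1 :> R)%R by rewrite invr_ge0.
pose mu k : {measure set _ -> \bar R} := mscale (NngNum r0)
  (measure_function_pushforward__canonical__measure_function_Measure p
    (measurable_pair_location k)).
move=> F mF tF mUF; rewrite [X in _ --> X](_ : _ =
    lim ((fun n => \sum_(0 <= i < n) instance_location_law p (F i)) @ \oo)).
  by apply: is_cvg_ereal_nneg_natsum => k _; exact: law_ge0.
rewrite nneseries_sum//; last by move=> k i _; exact: (measure_ge0 (mu k)).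
by apply: eq_bigr => /= k _; exact: (measure_semi_bigcup (mu k)).
Qed.

HB.instance Definition _ := isMeasure.Build _ _ _ (instance_location_law p)
  law0 law_ge0 law_sigma_additive.

Let lawT : instance_location_law p setT = 1.
Proof.
rewrite /instance_location_law.
under eq_bigr do rewrite /pushforward preimage_setT probability_setT mule1.
by rewrite sumEFin sumr_const card_ord -(mulr_natr m%:R^-1) mulVf// pnatr_eq0 -lt0n.
Qed.

HB.instance Definition _ := Measure_isProbability.Build _ _ _
  (instance_location_law p) lawT.

End Probability.

Definition location_risk (p : set (m.-tuple X * T) -> \bar R)
    (Q : 'M[R]_(c, m)) (h : X -> c.-tuple R) : \bar R :=
  \int[instance_location_law p]_w
    cross_entropy (Q^T *m softmax (h w.1))%R w.2.

End LocationRisk.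

(* Main.v *)
(** Writing N for |S(tau)| and g for the softmax, the definition of Q gives
    a q_k(x) >= 1/N sum_(Y in S(tau)) g_(y_k)(x), because a bounds the
    expected number of occurrences of every class.  Jensen's inequality for
    the logarithm then yields
    - log q_k(x) <= log a + 1/N sum_(Y in S(tau)) - log g_(y_k)(x),
    and averaging over the positions k and over the inputs gives the bound. *)

Require Import Defs.
From HB Require Import structures.
From mathcomp Require Import all_boot all_order all_algebra.
From mathcomp Require Import all_classical all_reals all_analysis.
From mathcomp Require Import lra measurable_realfun.

Set Implicit Arguments.
Unset Strict Implicit.

Import Order.TTheory GRing.Theory Num.Theory.
Local Open Scope classical_set_scope.
Local Open Scope ring_scope.

(** * Jensen's inequality for the logarithm *)

(** With [s] the weighted mean, apply the tangent bound ln t <= t - 1 at t = [x i / s]; the weighted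
    sum of the right-hand sides is zero. *)
Lemma jensen_ln (R : realType) (I : finType) (P : pred I) (w x : I -> R) :
  (forall i, P i -> 0 <= w i) -> (forall i, P i -> 0 < x i) ->
  \sum_(i | P i) w i = 1 ->
  \sum_(i | P i) w i * ln (x i) <= ln (\sum_(i | P i) w i * x i).
Proof.
move=> w0 x0 w1; set s := \sum_(i | P i) w i * x i.
have s_ge0 : 0 <= s by apply: sumr_ge0 => i Pi; rewrite mulr_ge0 ?w0// ltW ?x0.
have s_gt0 : 0 < s.
  (* Were the mean zero, every nonnegative term [w i * x i], hence every [w i], would vanish,
     against total weight 1. *)
  rewrite lt_neqAle s_ge0 andbT eq_sym; apply/negP => /eqP s0.
  have /eqP := w1; rewrite big1 => [|i Pi]; first by rewrite eq_sym oner_eq0.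
  apply/eqP; move: s0 => /eqP; rewrite psumr_eq0.
    move=> /allP/(_ i); rewrite mem_index_enum Pi => /(_ isT) /=.
    by rewrite mulf_eq0 (gt_eqF (x0 _ Pi)) orbF.
  by move=> j Pj; rewrite mulr_ge0 ?w0// ltW ?x0.
rewrite -subr_le0 -[ln s]mul1r -w1 mulr_suml -sumrB.
apply: (@le_trans _ _ (\sum_(i | P i) (w i * x i / s - w i))).
  apply: ler_sum => i Pi; rewrite -mulrBr -mulrA -{3}[w i]mulr1 -mulrBr.
  rewrite ler_wpM2l ?w0// -ln_div ?posrE ?x0//.
  rewrite -{1}(subrKC 1 (x i / s)) le_ln1Dx// ltrBrDl subrr.
  by rewrite divr_gt0 ?x0.
by rewrite sumrB -mulr_suml w1 divff ?gt_eqF// subrr.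
Qed.

(** * Softmax and cross-entropy: bounds and measurability *)

Section Softmax.
Variables (R : realType) (c : nat) (z : c.-tuple R).

(** The index [j] witnesses that there is a class at all, so that the sum is not empty. *)
Let denominator_gt0 (j : 'I_c) : 0 < \sum_(i < c) expR (tnth z i).
Proof.
by rewrite (bigD1 j)//= ltr_wpDr ?expR_gt0// sumr_ge0// => i _; rewrite expR_ge0.
Qed.

Lemma softmax_gt0 (j : 'I_c) : 0 < softmax z j ord0.
Proof. by rewrite mxE divr_gt0 ?expR_gt0 ?(denominator_gt0 j). Qed.

(* A form free of the inverse, whose measurability the library lacks. *)
Lemma softmaxE (j : 'I_c) :
  softmax z j ord0 = expR (tnth z j - ln (\sum_(i < c) expR (tnth z i))).
Proof. by rewrite mxE expRB lnK// posrE (denominator_gt0 j). Qed.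

Lemma softmax_sum (j : 'I_c) : \sum_i softmax z i ord0 = 1.
Proof.
under eq_bigr do rewrite mxE.
by rewrite -mulr_suml divff// gt_eqF ?(denominator_gt0 j).
Qed.

Lemma softmax_le1 (j : 'I_c) : softmax z j ord0 <= 1.
Proof.
rewrite -(softmax_sum j) (bigD1 j)//= lerDl sumr_ge0// => i _.
by rewrite ltW ?softmax_gt0.
Qed.

End Softmax.

Section CrossEntropy.
Variables (R : realType) (n : nat).

Lemma cross_entropyE (q : 'cV[R]_n) (y : 'I_n) : 0 < q y ord0 ->
  cross_entropy q y = (- ln (q y ord0))%:E.
Proof. by move=> q0; rewrite /cross_entropy lne_EFin. Qed.

Lemma cross_entropy_ge0 (q : 'cV[R]_n) (y : 'I_n) : q y ord0 <= 1 ->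
  (0 <= cross_entropy q y)%E.
Proof. by move=> q1; rewrite /cross_entropy oppe_ge0 lne_le0 lee_fin. Qed.

Lemma measurable_cross_entropy d (T : measurableType d) (q : T -> 'cV[R]_n)
    (y : 'I_n) : (forall x, 0 < q x y ord0) ->
  measurable_fun setT (fun x => q x y ord0) ->
  measurable_fun setT (fun x => cross_entropy (q x) y).
Proof.
move=> q0 mq; under eq_fun do rewrite cross_entropyE//.
apply/measurable_EFinP; apply: measurableT_comp => //.
exact: measurableT_comp (@measurable_ln R) mq.
Qed.

End CrossEntropy.

Lemma measurable_softmax (R : realType) d (T : measurableType d) (c : nat)
    (h : T -> c.-tuple R) (j : 'I_c) : measurable_fun setT h ->
  measurable_fun setT (fun x => softmax (h x) j ord0).
Proof.
move=> mh; under eq_fun do rewrite softmaxE.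
have mz i : measurable_fun setT (fun x => tnth (h x) i).
  exact: measurableT_comp (measurable_tnth i) mh.
apply: measurableT_comp => //; apply: measurable_funB => //.
apply: measurableT_comp; first exact: measurable_ln.
by apply: measurable_sum => i; exact: measurableT_comp.
Qed.

(** * Tools for measurability and integration *)

Lemma uniform_mean_ge0 (R : realType) (I : finType) (S : {set I})
    (f : I -> \bar R) : (forall i, 0 <= f i)%E -> (0 <= uniform_mean S f)%E.
Proof.
move=> f0; apply: mule_ge0; last exact: sume_ge0.
by rewrite lee_fin invr_ge0 ler0n.
Qed.

(** A preimage is a finite union of measurable rectangles, one for each value of the selector [u].
    The selector is later the position in one risk and the candidate set in the other. *)
Lemma measurable_fun_finite_selector d1 d2 d3 (U : measurableType d1)
    (V : measurableType d2) (W : measurableType d3) (I : finType)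
    (u : V -> I) (f : I -> U -> W) :
  (forall i, measurable (u @^-1` [set i])) ->
  (forall i, measurable_fun setT (f i)) ->
  measurable_fun setT (fun w : U * V => f (u w.2) w.1).
Proof.
move=> mu mf _ A mA; rewrite setTI.
rewrite (_ : _ @^-1` _ = \bigcup_i ((f i @^-1` A) `*` (u @^-1` [set i]))).
  apply: fin_bigcup_measurable => [|i _]; first exact: finite_finset.
  apply: measurableX => //.
  by rewrite -[X in measurable X]setTI; exact: mf.
apply/seteqP; split=> [[x v] /= Afx|[x v] [i _ [/= Afx ui]]].
  by exists (u v).
by rewrite /= ui.
Qed.

(** The sign of [r] is left free because [ln a] is negative when every class is rare; the bound is
    only almost sure because it will be known only where the concept is the target. *)
Lemma le_integral_addr (R : realType) d (T : measurableType d)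
    (p : probability T R) (f g : T -> \bar R) (r : R) :
  measurable_fun setT f -> measurable_fun setT g ->
  (forall x, 0 <= f x)%E -> (forall x, 0 <= g x)%E ->
  {ae p, forall x, (f x <= g x + r%:E)%E} ->
  (\int[p]_x f x <= \int[p]_x g x + r%:E)%E.
Proof.
move=> mf mg f0 g0 fg.
(* r = u - v with u, v >= 0: each constant is added on the side where the
   integrand stays nonnegative, so no integrability is needed. *)
pose u := Num.max r 0; pose v := Num.max (- r) 0.
have u0 : 0 <= u by rewrite le_max lexx orbT.
have v0 : 0 <= v by rewrite le_max lexx orbT.
have uv : u = r + v.
  by rewrite /u /v; case: (leP r 0) => r0; case: (leP (- r) 0) => r1 //; lra.
have integralDcst k (t : R) : measurable_fun setT k -> (forall x, 0 <= k x)%E ->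
    0 <= t -> (\int[p]_x (k x + t%:E) = \int[p]_x k x + t%:E)%E.
  move=> mk k0 t0; rewrite ge0_integralD//=.
  by rewrite integral_cst// [X in (_ * X)%E]probability_setT mule1.
rewrite -(@leeD2rE _ v%:E)// -(addeA _ r%:E) -EFinD -uv -!integralDcst//.
apply: ae_ge0_le_integral => //.
- by move=> x _; rewrite adde_ge0.
- exact: emeasurable_funD.
- by move=> x _; rewrite adde_ge0.
- exact: emeasurable_funD.
apply: filterS fg => x fgx _.
by rewrite uv EFinD addeA leeD2r.
Qed.

(** * Conditional law of the position given the class *)

Section LocationMatrix.
Variables (R : realType) (c m : nat) (pY : m.-tuple 'I_c -> R).
Hypothesis pY0 : forall Y, 0 <= pY Y.

Lemma label_position_law_ge0 j k : 0 <= label_position_law pY j k.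
Proof. by apply: sumr_ge0 => Y _; rewrite mulr_ge0 ?invr_ge0. Qed.

Lemma label_law_ge0 j : 0 <= label_law pY j.
Proof. by apply: sumr_ge0 => k _; exact: label_position_law_ge0. Qed.

Variable Q : 'M[R]_(c, m).
Hypothesis QP : location_matrix pY Q.

Lemma location_matrix_ge0 j k : 0 <= Q j k.
Proof.
have := QP j; case: eqP => [_ [+ _]|_ ->]; first exact.
by rewrite divr_ge0 ?label_position_law_ge0 ?label_law_ge0.
Qed.

Lemma location_matrix_sum j : \sum_k Q j k = 1.
Proof.
have := QP j; case: eqP => [_ [_ ->]//|/eqP l0 QE].
by under eq_bigr do rewrite QE; rewrite -mulr_suml divff.
Qed.

Lemma location_matrix_le1 j k : Q j k <= 1.
Proof.
rewrite -(location_matrix_sum j) (bigD1 k)//= lerDl sumr_ge0// => i _.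
exact: location_matrix_ge0.
Qed.

(** For a class of probability zero both sides vanish, since the joint probabilities are nonnegative
    with sum zero; the arbitrary row of [Q] is thus harmless. *)
Lemma label_position_lawE j k :
  label_position_law pY j k = label_law pY j * Q j k.
Proof.
have := QP j; case: eqP => [l0 _|/eqP l0 ->]; last by rewrite mulrC divfK.
rewrite l0 mul0r; move/eqP: l0.
rewrite psumr_eq0 => [|i _]; last exact: label_position_law_ge0.
by move=> /allP/(_ k); rewrite mem_index_enum => /(_ isT)/eqP.
Qed.

End LocationMatrix.

(** * Pointwise comparison of the two losses under uniform labels *)

Section UniformLabels.
Variables (R : realType) (c m : nat) (S : {set m.-tuple 'I_c}).
Variables (pY : m.-tuple 'I_c -> R) (Q : 'M[R]_(c, m)).
Hypothesis m_gt0 : (0 < m)%N.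
Hypothesis S_gt0 : (0 < #|S|)%N.
Hypothesis pYP : probability_vector pY.
Hypothesis pYS : forall Y, Y \in S -> pY Y = #|S|%:R^-1.
Hypothesis QP : location_matrix pY Q.

Let n : R := #|S|%:R.
Let n_gt0 : 0 < n. Proof. by rewrite ltr0n. Qed.
Let mR_gt0 : 0 < m%:R :> R. Proof. by rewrite ltr0n. Qed.

Let frequency i := n^-1 * \sum_(Y in S) \sum_(k < m) (tnth Y k == i)%:R.
(** The default 0 does not affect the maximum, as frequencies are nonnegative. *)
Let a := \big[Num.max/0]_(i < c) frequency i.

(** The masses on [S] already add up to 1, so the nonnegative masses outside have sum zero. *)
Lemma uniform_support Y : pY Y = if Y \in S then n^-1 else 0.
Proof.
case: pYP => pY0 pY1; case: ifPn => [/pYS//|YS].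
move: pY1; rewrite (bigID (mem S))/= (eq_bigr (fun=> n^-1)) => [|Z /pYS//].
rewrite sumr_const -(mulr_natr n^-1) mulVf ?gt_eqF// => /eqP.
rewrite -subr_eq0 addrAC subrr add0r psumr_eq0// => /allP/(_ Y).
by rewrite mem_index_enum YS => /(_ isT)/eqP.
Qed.

Lemma uniform_label_position_law j k :
  m%:R * label_position_law pY j k = n^-1 * \sum_(Y in S) (tnth Y k == j)%:R.
Proof.
rewrite /label_position_law -mulr_suml mulrCA divff ?gt_eqF// mulr1.
rewrite big_mkcond [in RHS]big_mkcond mulr_sumr.
apply: eq_bigr => Y _; rewrite uniform_support.
by case: ifP; case: ifP; rewrite ?mulr1 ?mulr0.
Qed.

(** This links [a] to the denominator in the definition of [Q]. *)
Lemma frequencyE j : frequency j = m%:R * label_law pY j.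
Proof.
rewrite /label_law mulr_sumr /frequency exchange_big mulr_sumr.
by apply: eq_bigr => k _; rewrite uniform_label_position_law.
Qed.

Lemma frequency_le_max j : frequency j <= a.
Proof. exact: le_bigmax. Qed.

(** Each candidate sequence has only [m] positions in which a class can occur. *)
Lemma max_frequency_le : a <= m%:R.
Proof.
apply: bigmax_le => [|i _]; first exact: ltW.
rewrite ler_pdivrMl// mulr_natl -sumr_const; apply: ler_sum => Y _.
rewrite -[m in leRHS]card_ord -sum1_card natr_sum.
by apply: ler_sum => k _; rewrite lern1 leq_b1.
Qed.

(** The class at the first position of some candidate has positive frequency. *)
Lemma max_frequency_gt0 : 0 < a.
Proof.
have /card_gt0P[Y YS] := S_gt0; pose j := tnth Y (Ordinal m_gt0).
apply: lt_le_trans (frequency_le_max j).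
rewrite mulr_gt0 ?invr_gt0// (bigD1 Y)//= (bigD1 (Ordinal m_gt0))//= eqxx.
rewrite ltr_wpDr ?ltr_wpDr ?sumr_ge0// => Z _.
by rewrite sumr_ge0.
Qed.

Section Pointwise.
Variable g : 'cV[R]_c.
Hypothesis g_gt0 : forall j, 0 < g j ord0.

(** Grouping the candidates by their label j at position k gives each g_j the coefficient
    [m%:R * label_position_law pY j k], which is [frequency j * Q j k], at most [a * Q j k]. *)
Lemma mean_le_location k :
  \sum_(Y in S) n^-1 * g (tnth Y k) ord0 <= a * (Q^T *m g) k ord0.
Proof.
have [pY0 _] := pYP.
rewrite (partition_big (fun Y : m.-tuple 'I_c => tnth Y k) predT)//=.
rewrite mxE mulr_sumr; apply: ler_sum => j _; rewrite mxE mulrA.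
rewrite (eq_bigr (fun=> n^-1 * g j ord0)) => [|Y /andP[_ /eqP->]//].
rewrite -mulr_suml ler_pM2r//.
have -> : \sum_(Y in S | tnth Y k == j) n^-1 = m%:R * label_position_law pY j k.
  rewrite uniform_label_position_law mulr_sumr big_mkcondr; apply: eq_bigr => Y _.
  by case: ifP; rewrite ?mulr1 ?mulr0.
rewrite (label_position_lawE pY0 QP) mulrA -frequencyE.
by rewrite ler_wpM2r ?frequency_le_max// (location_matrix_ge0 pY0 QP).
Qed.

(** Entries of [Q] may vanish, but the mean bounded in [mean_le_location] is positive. Hence every
    location loss is finite. *)
Lemma location_gt0 k : 0 < (Q^T *m g) k ord0.
Proof.
rewrite -(pmulr_rgt0 _ max_frequency_gt0); apply: lt_le_trans (mean_le_location k).
have /card_gt0P[Y YS] := S_gt0.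
rewrite (bigD1 Y)//= ltr_wpDr ?sumr_ge0 ?mulr_gt0 ?invr_gt0// => Z _.
by rewrite mulr_ge0 ?invr_ge0 ?ltW.
Qed.

Lemma location_le1 k : \sum_j g j ord0 = 1 -> (Q^T *m g) k ord0 <= 1.
Proof.
have [pY0 _] := pYP.
move=> <-; rewrite mxE; apply: ler_sum => j _; rewrite mxE.
by rewrite ler_piMl ?(location_matrix_le1 pY0 QP)// ltW.
Qed.

Lemma location_loss_le k :
  - ln ((Q^T *m g) k ord0) <=
    \sum_(Y in S) n^-1 * (- ln (g (tnth Y k) ord0)) + ln a.
Proof.
under eq_bigr do rewrite mulrN.
rewrite sumrN lerNl opprD opprK lerBlDr -lnM ?posrE ?location_gt0 ?max_frequency_gt0//.
(* Jensen with uniform weights on [S] gives the first inequality, [mean_le_location] the second. *)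
apply: (@le_trans _ _ (ln (\sum_(Y in S) n^-1 * g (tnth Y k) ord0))).
  apply: jensen_ln => [Y _|//|]; first by rewrite invr_ge0 ltW.
  by rewrite sumr_const -(mulr_natr n^-1) mulVf ?gt_eqF.
rewrite ler_ln ?posrE 1?mulrC ?mean_le_location//.
- have /card_gt0P[Y YS] := S_gt0.
  rewrite (bigD1 Y)//= ltr_wpDr ?sumr_ge0 ?mulr_gt0 ?invr_gt0// => Z _.
  by rewrite mulr_ge0 ?invr_ge0 ?ltW.
- by rewrite mulr_gt0 ?location_gt0 ?max_frequency_gt0.
Qed.

End Pointwise.

Lemma mean_location_loss_le (g : 'I_m -> 'cV[R]_c) :
  (forall k j, 0 < g k j ord0) ->
  ((m%:R^-1)%:E * \sum_(k < m) cross_entropy (Q^T *m g k) k <=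
   uniform_mean S (fun Y => (m%:R^-1)%:E *
     \sum_(k < m) cross_entropy (g k) (tnth Y k)) + (ln a)%:E)%E.
Proof.
move=> g0; under eq_bigr do rewrite cross_entropyE ?location_gt0//.
rewrite /uniform_mean; under [X in (_ <= _ * X + _)%E]eq_bigr => Y _.
  under eq_bigr do rewrite cross_entropyE//.
  rewrite sumEFin -EFinM; over.
rewrite !sumEFin -!EFinM -EFinD lee_fin -mulr_sumr mulrCA exchange_big/=.
(* The constant [ln a] becomes the average of [m] copies of itself, so that the comparison can be
   made position by position. *)
rewrite [#|S|%:R^-1 * _]mulr_sumr -[ln a](mulKf (lt0r_neq0 mR_gt0)) -mulrDr.
have -> : m%:R * ln a = \sum_(k < m) ln a.
  by rewrite sumr_const card_ord mulr_natl.
rewrite ler_pM2l ?invr_gt0// -big_split/=.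
by apply: ler_sum => k _; rewrite mulr_sumr location_loss_le.
Qed.

End UniformLabels.

(** * From the pointwise bound to the risks *)

(** The law of the instance-location pair is a finite sum of scaled pushforwards of [p]; a change of
    variables in each summand brings both risks under the same measure. *)
Lemma location_riskE (R : realType) (dX dT : measure_display)
    (X : measurableType dX) (T : measurableType dT) (c m : nat)
    (m_gt0 : (0 < m)%N) (p : probability (m.-tuple X * T)%type R)
    (Q : 'M[R]_(c, m)) (h : X -> c.-tuple R) :
  (forall k, measurable_fun setT
    (fun x => cross_entropy (Q^T *m softmax (h x)) k)) ->
  (forall x k, 0 <= cross_entropy (Q^T *m softmax (h x)) k)%E ->
  (location_risk m_gt0 p Q h =
    \int[p]_w ((m%:R^-1)%:E *
      \sum_(k < m) cross_entropy (Q^T *m softmax (h (tnth w.1 k))) k))%E.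
Proof.
move=> mloss loss0; rewrite /location_risk.
pose loss (w : X * positions m_gt0) := cross_entropy (Q^T *m softmax (h w.1)) w.2.
have mpair (k : 'I_m) : measurable_fun setT
    (fun w : m.-tuple X * T => (tnth w.1 k, k) : X * positions m_gt0).
  apply: measurable_fun_pair; last exact: measurable_cst.
  exact: (measurableT_comp (measurable_tnth k) measurable_fst).
have mtnth (k : 'I_m) : measurable_fun setT (fun w : m.-tuple X * T =>
    cross_entropy (Q^T *m softmax (h (tnth w.1 k))) k).
  exact: (measurableT_comp (mloss k)
    (measurableT_comp (measurable_tnth k) measurable_fst)).
have mlossT : measurable_fun setT loss.
  exact: (@measurable_fun_finite_selector _ _ _ X (positions m_gt0) _ 'I_m id
    (fun k x => cross_entropy (Q^T *m softmax (h x)) k)).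
have r0 : 0 <= m%:R^-1 :> R by rewrite invr_ge0.
(* [msum] takes a family indexed by [nat]; [insubd] gives indices from [m] on the first position,
   and the sum stops before them. *)
pose mu (i : nat) : {measure set (X * positions m_gt0) -> \bar R} :=
  mscale (NngNum r0)
    (measure_function_pushforward__canonical__measure_function_Measure p
      (mpair (insubd (Ordinal m_gt0) i))).
have -> : instance_location_law p = msum mu m.
  apply/funext => A; apply: eq_bigr => k _.
  by rewrite /mu /mscale/= valKd.
rewrite ge0_integral_measure_sum//.
rewrite ge0_integralZl//; last 2 first.
- exact: emeasurable_sum.
- by move=> w _; exact: sume_ge0.
rewrite ge0_integral_sum// ge0_sume_distrr; last first.
  by move=> k _; exact: integral_ge0.
apply: eq_bigr => k _.
rewrite ge0_integral_mscale//= ge0_integral_pushforward//.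
by rewrite valKd.
Qed.

(** Logic is abstracted away here: entailment enters only through a measurable map [S] to candidate
    sets and a target [tau] of mass 1. *)
Lemma location_risk_le (R : realType) (dX dT : measure_display)
    (X : measurableType dX) (T : measurableType dT) (c m : nat)
    (m_gt0 : (0 < m)%N) (p : probability (m.-tuple X * T)%type R)
    (S : T -> {set m.-tuple 'I_c}) (tau : T)
    (pY : m.-tuple 'I_c -> R) (Q : 'M[R]_(c, m)) (h : X -> c.-tuple R) :
  measurable [set tau] -> (forall A, measurable (S @^-1` [set A])) ->
  p ([set: m.-tuple X] `*` [set tau]) = 1%E ->
  (0 < #|S tau|)%N -> probability_vector pY ->
  (forall Y, Y \in S tau -> pY Y = #|S tau|%:R^-1) ->
  location_matrix pY Q -> measurable_fun setT h ->
  (location_risk m_gt0 p Q h <= nesy_risk p S h +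
    (ln (\big[Num.max/0]_(i < c) (#|S tau|%:R^-1 *
      \sum_(Y in S tau) \sum_(k < m) (tnth Y k == i)%:R)))%:E)%E.
Proof.
move=> mtau mS p_tau S_gt0 pYP pYS QP mh.
have /card_gt0P[Y0 Y0S] := S_gt0; pose j0 := tnth Y0 (Ordinal m_gt0).
have q_gt0 x k : 0 < (Q^T *m softmax (h x)) k ord0.
  by apply: (location_gt0 m_gt0 S_gt0 pYP pYS QP) => j; exact: softmax_gt0.
have q_le1 x k : (Q^T *m softmax (h x)) k ord0 <= 1.
  apply: (location_le1 pYP QP) => [j|]; first exact: softmax_gt0.
  exact: softmax_sum j0.
have mq k : measurable_fun setT (fun x => cross_entropy (Q^T *m softmax (h x)) k).
  apply: measurable_cross_entropy => //; under eq_fun do rewrite mxE.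
  by apply: measurable_sum => j; apply: measurable_funM => //; exact: measurable_softmax.
rewrite location_riskE// => [|x k]; last exact: cross_entropy_ge0.
apply: le_integral_addr.
- apply: measurable_funeM; apply: emeasurable_sum => k.
  exact: (measurableT_comp (mq k)
    (measurableT_comp (measurable_tnth k) measurable_fst)).
(* The integrand depends on the concept only through its candidate set, which takes finitely many
   values. *)
- apply: (@measurable_fun_finite_selector _ _ _ (m.-tuple X) T _ _ S
    (fun A xs => uniform_mean A (fun Y => (m%:R^-1)%:E *
      \sum_(k < m) cross_entropy (softmax (h (tnth xs k))) (tnth Y k))%E)) => // A.
  apply: measurable_funeM; rewrite /=.
  under eq_fun do rewrite big_mkcond/=.
  apply: emeasurable_sum => Y; case: (Y \in A) => //.
  apply: measurable_funeM; apply: emeasurable_sum => k.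
  apply: measurable_cross_entropy => [xs|]; first exact: softmax_gt0.
  exact: (measurableT_comp (measurable_softmax (tnth Y k) mh) (measurable_tnth k)).
- move=> w; rewrite mule_ge0 ?lee_fin ?invr_ge0// sume_ge0// => k _.
  exact: cross_entropy_ge0.
- move=> w; apply: uniform_mean_ge0 => Y.
  rewrite mule_ge0 ?lee_fin ?invr_ge0// sume_ge0// => k _.
  by apply: cross_entropy_ge0; exact: softmax_le1.
have mC : measurable ([set: m.-tuple X] `*` [set tau]) by exact: measurableX.
(* The exceptional null set consists of the pairs whose concept differs from [tau]. *)
exists (~` ([set: m.-tuple X] `*` [set tau])); split.
- exact: measurableC.
- by rewrite probability_setC// p_tau subee.
apply: subsetC => -[xs t] [_ /= ->].
apply: (mean_location_loss_le m_gt0 S_gt0 pYP pYS QP) => k j.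
exact: softmax_gt0.
Qed.

Unset Implicit Arguments.

Theorem theorem1 (R : realType) (d c m : nat) (m_gt0 : (0 < m)%N)
    (X : set (d.-tuple R)) (X0 : X !=set0)
    (L : signature) (fact : 'I_m -> 'I_c -> formula L)
    (B : set (formula L)) (T : set (formula L)) (tau : formula L)
    (p : probability (m.-tuple (inputs X0) * formula L)%type R)
    (pY : m.-tuple 'I_c -> R) (Q : 'M[R]_(c, m))
    (h : inputs X0 -> c.-tuple R) :
  p ([set: m.-tuple (inputs X0)] `*` T) = 1%E ->
  T = [set tau] ->
  let S := candidates fact B in
  (0 < #|S tau|)%N ->
  probability_vector pY ->
  (forall Y, Y \in S tau -> pY Y = #|S tau|%:R^-1) ->
  location_matrix pY Q ->
  measurable_fun [set: inputs X0] h ->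
  let a := \big[Num.max/0]_(i < c)
    (#|S tau|%:R^-1 *
     \sum_(Y in S tau) \sum_(k < m) (tnth Y k == i)%:R) in
  (location_risk m_gt0 p Q h <= nesy_risk p S h + (ln a)%:E)%E /\
  ln a <= ln m%:R.
Proof.
move=> p_T TE S S_gt0 pYP pYS QP mh a; split.
  (* The measurability conditions are immediate, as formulas carry the discrete sigma-algebra. *)
  by apply: (location_risk_le m_gt0 (tau := tau) _ _ _ S_gt0 pYP) => //; rewrite -TE.
have mR_gt0 : 0 < m%:R :> R by rewrite ltr0n.
by rewrite ler_ln ?posrE ?max_frequency_gt0// max_frequency_le.
Qed.
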